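(* Let $\Sigma$ be a set and $A=\mathbb{Z}[t]$. The partial monoid $\mathrm{CDR}(A,\Sigma)$ embeds into the group $\mathrm{E}(A,F(\Sigma))$. That is: the map sending a word in $\mathrm{CDR}(A,\Sigma)$ to the element of $\mathrm{E}(A,F(\Sigma))$ it represents is injective, and, for $x,y\in\mathrm{CDR}(A,\Sigma)$, the product $x*y$ is defined in the partial monoid $\mathrm{CDR}(A,\Sigma)$ if and only if the product $xy$ computed in $\mathrm{E}(A,F(\Sigma))$ belongs to (the image of) $\mathrm{CDR}(A,\Sigma)$, in which case $x*y=xy$.
   Context: Ordered group. $A=\mathbb{Z}[t]$ is the additive group of integer polynomials, ordered by $\alpha\le\beta$ iff $\alpha=\beta$ or $\beta-\alpha$ has positive leading coefficient; $\mathbb{Z}\subseteq A$ as constants, and $1$ is the least positive element. Words. $G=F(\Sigma)$ is the free group with basis $\Sigma$; $\Gamma=\Sigma\cup\Sigma^{-1}\subseteq G$, $\overline a=a^{-1}$ for $a\in\Gamma$, and $\pi:\Gamma^*\to G$ is the induced monoid homomorphism. A (closed) $A$-word of length $\alpha\ge 0$ is a map $p:[1,\alpha]\to\Gamma$, where $[1,\alpha]=\{\beta\in A: 1\le\beta\le\alpha\}$; $|p|=\alpha$. $W(A,\Gamma)$ is the monoid of $A$-words under concatenation: $(p\cdot q)(\beta)=p(\beta)$ for $1\le\beta\le|p|$ and $(p\cdot q)(\beta)=q(\beta-|p|)$ for $|p|<\beta\le|p|+|q|$. The involution is $\overline p(\beta)=\overline{p(|p|+1-\beta)}$. A word is finite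 if $|p|\in\mathbb{N}$; finite words are identified with elements of $\Gamma^*$. A word $x$ is freely reduced if $x(\beta)\neq\overline{x(\beta+1)}$ for all $1\le\beta<|x|$, and cyclically reduced if $xx$ is freely reduced. $R(A,G)$ is the set of $G$-reduced words, i.e. those having no non-empty finite factor equal to $1$ in $G$; for $G=F(\Sigma)$ these are exactly the freely reduced words. $R^*(A,G)$ is the submonoid of $W(A,\Gamma)$ generated by $R(A,G)$. The group $\mathrm{E}(A,G)$. $\mathcal{M}(A,G)$ is the quotient monoid of $W(A,\Gamma)$ by the relations $u\,\ell\,\overline{r}\,\overline{u}=1$ for all $u\in R(A,G)$ and $\ell,r\in\Gamma^*$ with $\pi(\ell)=\pi(r)$. $\mathrm{E}(A,G)$ is the image of $R^*(A,G)$ in $\mathcal{M}(A,G)$; it is a group, and the inverse of the class of $u\in R(A,G)$ is the class of $\overline u$. The partial monoid $\mathrm{CDR}(A,\Sigma)$. For freely reduced words $x,y$, the partial product $x*y$ is defined iff there are words $p,q,r$ with $x=pq$, $y=\overline q\,r$ and $pr$ freely reduced; then $x*y=pr$. $\mathrm{CDR}(A,\Sigma)$ is the set of freely reduced words $x$ admitting a cyclically reduced decomposition $x=c\,u\,\overline c$ (concatenation in $W(A,\Gamma)$) with $u$ cyclically reduced. In $\mathrm{CDR}(A,\Sigma)$ the product $x*y$ of $x,y\in\mathrm{CDR}(A,\Sigma)$ is considered defined iff there are words $p,q,r$ with $x=pq$, $y=\overline q\,r$ and $pr$ freely reduced, and the value $x*y=pr$ lies in $\mathrm{CDR}(A,\Sigma)$.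 *)

(* Defs.v *)
From HB Require Import structures.
From mathcomp Require Import all_boot all_order all_algebra.
From mathcomp Require Import boolp.
From mathcomp Require Import lra.

Set Implicit Arguments.
Unset Strict Implicit.
Unset Printing Implicit Defensive.

Import Order.TTheory GRing.Theory Num.Theory.

Local Open Scope quotient_scope.
Local Open Scope ring_scope.

(* An alias, so that the leading-coefficient order is attached to [Zt] only
   and not to every {poly int}. *)
Definition Zt := {poly int}.

HB.instance Definition _ := GRing.IntegralDomain.on Zt.

Definition leZt (a b : Zt) : bool := (a == b) || (0 < lead_coef (b - a)).
Definition ltZt (a b : Zt) : bool := (b != a) && leZt a b.
Definition normZt (a : Zt) : Zt := if leZt 0 a then a else - a.

Fact le0_leZt (a : Zt) : leZt 0 a = (0 <= lead_coef a).
Proof.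
by rewrite /leZt subr0 le_eqVlt ![0 == _]eq_sym lead_coef_eq0.
Qed.

Fact sub_ge0Zt (a b : Zt) : leZt 0 (b - a) = leZt a b.
Proof. by rewrite /leZt subr0 ![_ == b - a]eq_sym subr_eq0 [b == a]eq_sym. Qed.

Fact leZt_0 (a : Zt) : leZt a 0 = (lead_coef a <= 0).
Proof. by rewrite -sub_ge0Zt sub0r le0_leZt lead_coefN oppr_ge0. Qed.

Fact le0_addZt (a b : Zt) : leZt 0 a -> leZt 0 b -> leZt 0 (a + b).
Proof.
rewrite !le0_leZt => ha hb; case: (ltngtP (size a) (size b)) => [h|h|h].
- by rewrite lead_coefDr.
- by rewrite lead_coefDl.
have [e|ne] := eqVneq (lead_coef a + lead_coef b) 0.
  move/eqP: e; rewrite paddr_eq0 // !lead_coef_eq0 => /andP[/eqP -> /eqP ->].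
  by rewrite addr0 lead_coef0.
have sD : size (a + b) = size a.
  apply/eqP; rewrite eqn_leq (leq_trans (size_polyD _ _)) ?h ?maxnn //=.
  case: (posnP (size b)) => [->//|hs]; rewrite -(prednK hs).
  apply: contraNT ne; rewrite -leqNgt => hl.
  by rewrite !lead_coefE h -coefD nth_default.
by rewrite lead_coefE sD coefD {2}h -!lead_coefE addr_ge0.
Qed.

Fact le0_mulZt (a b : Zt) : leZt 0 a -> leZt 0 b -> leZt 0 (a * b).
Proof. by rewrite !le0_leZt lead_coefM; apply: mulr_ge0. Qed.

Fact le0_antiZt (a : Zt) : leZt 0 a -> leZt a 0 -> a = 0.
Proof.
by rewrite le0_leZt leZt_0 => h1 h2; apply/eqP; rewrite -lead_coef_eq0 eq_le h1 h2.
Qed.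

Fact le0_totalZt (a : Zt) : leZt 0 a || leZt a 0.
Proof. by rewrite le0_leZt leZt_0 le_total. Qed.

Fact normNZt (a : Zt) : normZt (- a) = normZt a.
Proof.
rewrite /normZt !le0_leZt lead_coefN oppr_ge0 opprK.
case: (ltgtP (lead_coef a) 0) => // /eqP.
by rewrite lead_coef_eq0 => /eqP ->; rewrite oppr0.
Qed.

Fact ge0_normZt (a : Zt) : leZt 0 a -> normZt a = a.
Proof. by rewrite /normZt => ->. Qed.

HB.instance Definition _ := Num.IntegralDomain_isLeReal.Build Zt
  le0_addZt le0_mulZt le0_antiZt sub_ge0Zt le0_totalZt normNZt ge0_normZt
  (fun a b => erefl (ltZt a b)).


Lemma leZtE (a b : Zt) : (a <= b) = (a == b) || (0 < lead_coef (b - a)).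
Proof. by []. Qed.

Lemma gt0_ge1_Zt (a : Zt) : 0 < a -> 1 <= a.
Proof.
rewrite lt_def leZtE subr0 [0 == a]eq_sym => /andP[/negPf -> /=] ha.
rewrite leZtE; have [s1|s1] := leqP (size a) 1.
  move: ha; rewrite (size1_polyC s1) lead_coefC => hc.
  rewrite -(polyCB _ 1) lead_coefC.
  by rewrite (inj_eq polyC_inj (1 : int)) subr_gt0 -le_eqVlt -gtz0_ge1.
by rewrite lead_coefDl ?ha ?orbT // size_polyN size_poly1.
Qed.

(* Σ ∪ Σ^-1: [(a, false)] stands for the generator a and [(a, true)] for its
   inverse. *)
Definition letter (Sigma : Type) : Type := (Sigma * bool)%type.
HB.instance Definition _ (Sigma : Type) := gen_eqMixin (letter Sigma).
HB.instance Definition _ (Sigma : Type) := gen_choiceMixin (letter Sigma).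

Definition linv (Sigma : Type) (a : letter Sigma) : letter Sigma :=
  (a.1, ~~ a.2).

Lemma linvK (Sigma : Type) : involutive (@linv Sigma).
Proof. by case=> a b; rewrite /linv /= negbK. Qed.

Inductive cong (M : monoidType) (S : M -> M -> Prop) : M -> M -> Prop :=
  | cong_rel x y : S x y -> cong S x y
  | cong_refl x : cong S x x
  | cong_sym x y : cong S x y -> cong S y x
  | cong_trans x y z : cong S x y -> cong S y z -> cong S x z
  | cong_mul x y x' y' :
      cong S x x' -> cong S y y' -> cong S (x * y)%g (x' * y')%g.

Section MonoidQuotient.
Variables (M : monoidType) (S : M -> M -> Prop).

Let congb (x y : M) := `[< cong S x y >].

Fact congb_refl : reflexive congb.
Proof. by move=> x; apply/asboolP; apply: cong_refl. Qed.

Fact congb_sym : symmetric congb.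
Proof. by move=> x y; apply/asboolP/asboolP; apply: cong_sym. Qed.

Fact congb_trans : transitive congb.
Proof.
by move=> y x z /asboolP h1 /asboolP h2; apply/asboolP; apply: cong_trans h1 h2.
Qed.

Canonical cong_equiv := EquivRel congb congb_refl congb_sym congb_trans.

Definition mquot : Type := {eq_quot cong_equiv}.
HB.instance Definition _ := Choice.on mquot.
HB.instance Definition _ := Quotient.on mquot.

Definition mproj (x : M) : mquot := \pi_mquot x.

Lemma mprojP (x y : M) : mproj x = mproj y <-> cong S x y.
Proof.
split=> [/eqmodP/asboolP //|h]; apply/eqmodP; exact/asboolP.
Qed.

Lemma mprojK (m : mquot) : mproj (repr m) = m.
Proof. exact: reprK. Qed.

Definition mquot_one : mquot := mproj 1%g.
Definition mquot_mul (a b : mquot) : mquot := mproj (repr a * repr b)%g.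

Fact mproj_mul (x y : M) : mproj (x * y)%g = mquot_mul (mproj x) (mproj y).
Proof.
by apply/mprojP; apply: cong_mul; apply/mprojP; rewrite mprojK.
Qed.

Fact mquot_mulA : associative mquot_mul.
Proof.
move=> a b c; rewrite -[a]mprojK -[b]mprojK -[c]mprojK.
by rewrite -!mproj_mul mulgA.
Qed.

Fact mquot_mul1 : left_id mquot_one mquot_mul.
Proof. by move=> a; rewrite -[a]mprojK -mproj_mul mul1g. Qed.

Fact mquot_mulr1 : right_id mquot_one mquot_mul.
Proof. by move=> a; rewrite -[a]mprojK -mproj_mul mulg1. Qed.

HB.instance Definition _ :=
  isMonoid.Build mquot mquot_mulA mquot_mul1 mquot_mulr1.

Lemma mprojM (x y : M) : mproj (x * y)%g = (mproj x * mproj y)%g.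
Proof. exact: mproj_mul. Qed.

Lemma mproj1 : mproj 1%g = 1%g.
Proof. by []. Qed.

End MonoidQuotient.

Section FreeGroup.
Variable Sigma : Type.

Definition fword : Type := seq (letter Sigma).
HB.instance Definition _ := Choice.on fword.
HB.instance Definition _ :=
  isMonoid.Build fword (@catA (letter Sigma)) (@cat0s _) (@cats0 _).

Inductive cancel_rel : fword -> fword -> Prop :=
  CancelRel a : cancel_rel [:: a; linv a] [::].

Definition free_group : Type := mquot cancel_rel.
HB.instance Definition _ := Monoid.on free_group.

Definition fpi (s : fword) : free_group := mproj cancel_rel s.

Lemma fpi_nil : fpi [::] = 1%g.
Proof. by []. Qed.

Lemma fpi_cat (s t : fword) : fpi (s ++ t) = (fpi s * fpi t)%g.
Proof. exact: mprojM. Qed.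

Definition finv (s : fword) : fword := rev (map (@linv Sigma) s).

Lemma finvK : involutive finv.
Proof.
by move=> s; rewrite /finv map_rev revK -map_comp map_id_in // => a _ /=; rewrite linvK.
Qed.

Lemma finv_cat (s t : fword) : finv (s ++ t) = finv t ++ finv s.
Proof. by rewrite /finv map_cat rev_cat. Qed.

Lemma fpi_mulV (s : fword) : (fpi s * fpi (finv s))%g = 1%g.
Proof.
rewrite -fpi_cat -fpi_nil; elim: s => [//|a s IH].
rewrite -cat1s finv_cat catA -[_ ++ finv s]catA fpi_cat.
rewrite (fpi_cat _ (s ++ _)) IH fpi_nil mulg1 -fpi_cat.
by apply/mprojP; apply: cong_rel; apply: CancelRel.
Qed.

Lemma fpi_Vmul (s : fword) : (fpi (finv s) * fpi s)%g = 1%g.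
Proof. by rewrite -{2}[s]finvK fpi_mulV. Qed.

Definition free_group_inv (g : free_group) : free_group := fpi (finv (repr g)).

Fact free_group_mulVg : left_inverse 1%g free_group_inv *%g.
Proof. by move=> g; rewrite -{2}[g]mprojK fpi_Vmul. Qed.

Fact free_group_mulgV : right_inverse 1%g free_group_inv *%g.
Proof. by move=> g; rewrite -{1}[g]mprojK fpi_mulV. Qed.

HB.instance Definition _ := hasInv.Build free_group free_group_inv.
HB.instance Definition _ :=
  Monoid_isGroup.Build free_group free_group_mulVg free_group_mulgV.

Lemma fpi_finv (s : fword) : fpi (finv s) = (fpi s)^-1%g.
Proof. by apply: (mulgI (fpi s)); rewrite fpi_mulV mulgV. Qed.

Definition fred (s : fword) : bool := sorted (fun a b => b != linv a) s.

Let push (a : letter Sigma) (s : fword) : fword :=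
  if s is b :: s' then if b == linv a then s' else a :: s else [:: a].

Let push_red a s : fred s -> fred (push a s).
Proof.
by case: s => [//|b s] /= h; case: ifPn => [_|nb]; [apply: path_sorted h | rewrite /fred /= nb].
Qed.

Let pushK a s : fred s -> push a (push (linv a) s) = s.
Proof.
case: s => [|b s] /=; first by rewrite eqxx.
rewrite linvK; case: ifPn => [/eqP ->|nb _]; last by rewrite /= eqxx.
by case: s => [|c s] //= /andP[/negPf ->].
Qed.

Let foldr_push_red s t : fred t -> fred (foldr push t s).
Proof. by move=> ht; elim: s => //= a s IH; apply: push_red. Qed.

Let foldr_push_cong s s' : cong cancel_rel s s' ->
  forall t, fred t -> foldr push t s = foldr push t s'.
Proof.
elim=> {s s'} [_ _ [a] t ht|//|x y _ IH t ht|x y z _ IH1 _ IH2 t ht|x y x' y' _ IH1 _ IH2 t ht].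
- exact: pushK.
- by rewrite IH.
- by rewrite IH1 ?IH2.
- by rewrite !foldr_cat IH2 // IH1 // foldr_push_red.
Qed.

Let foldr_push_id s : fred s -> foldr push [::] s = s.
Proof.
elim: s => //= a s IH h; rewrite IH; last exact: path_sorted h.
by case: s h {IH} => [//|b s] /= /andP[/negPf ->].
Qed.

Lemma fred_fpi1 (s : fword) : fred s -> fpi s = 1%g -> s = [::].
Proof.
move=> hs /mprojP h; rewrite -(foldr_push_id hs).
exact: (foldr_push_cong h).
Qed.

Lemma not_fred (s : fword) :
  ~~ fred s -> exists s1 a s2, s = s1 ++ [:: a; linv a] ++ s2.
Proof.
elim: s => // a [//|b s] IH /=; rewrite negb_and negbK => /orP[/eqP ->|h].
  by exists [::], a, s.
by have [s1 [c [s2 ->]]] := IH h; exists (a :: s1), c, s2.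
Qed.

End FreeGroup.

(* A word p : [1, α] -> Γ is represented by a partial function on [Zt] which
   is defined exactly on [1, α]. *)
Record word (Sigma : Type) : Type := Word {
  wlen : Zt;
  wfun :> Zt -> option (letter Sigma);
  wlen_ge0 : 0 <= wlen;
  wfunE : forall b, isSome (wfun b) = (1 <= b <= wlen) }.

HB.instance Definition _ (Sigma : Type) := gen_eqMixin (word Sigma).
HB.instance Definition _ (Sigma : Type) := gen_choiceMixin (word Sigma).

Section Words.
Variable Sigma : Type.
Implicit Types (p q r u w x y z : word Sigma) (b : Zt).

Lemma word_eq p q : wlen p = wlen q -> wfun p =1 wfun q -> p = q.
Proof.
case: p q => [l f hl hf] [l' f' hl' hf'] /= el /funext ef.
by case: l' / el hl' hf'; case: f' / ef => hl' hf'; congr Word; apply: Prop_irrelevance.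
Qed.

Lemma wfun_out p b : ~~ (1 <= b <= wlen p) -> p b = None.
Proof. by rewrite -wfunE; case: (p b). Qed.

Fact wone_ge0 : 0 <= (0 : Zt). Proof. exact: lexx. Qed.
Fact wone_funE b : isSome (None : option (letter Sigma)) = (1 <= b <= 0).
Proof. by apply/esym/negP => /andP[h1 h2]; have := le_trans h1 h2; rewrite ler10. Qed.
Definition wone : word Sigma := Word wone_ge0 wone_funE.

Fact wcat_ge0 p q : 0 <= wlen p + wlen q.
Proof. by rewrite addr_ge0 ?wlen_ge0. Qed.
Fact wcat_funE p q b :
  isSome (if b <= wlen p then p b else q (b - wlen p))
  = (1 <= b <= wlen p + wlen q).
Proof.
have hp := wlen_ge0 p; have hq := wlen_ge0 q.
case: (leP b (wlen p)) => h; rewrite wfunE.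
  by apply/andP/andP => -[h1 h2]; split; lra.
have := @gt0_ge1_Zt (b - wlen p); rewrite subr_gt0 => /(_ h) h'.
by apply/andP/andP => -[h1 h2]; split; lra.
Qed.
Definition wcat p q : word Sigma := Word (wcat_ge0 p q) (wcat_funE p q).

Fact wcatA : associative wcat.
Proof.
move=> p q r; apply: word_eq => [/=|b /=]; first by rewrite addrA.
have hp := wlen_ge0 p; have hq := wlen_ge0 q.
rewrite lerBlDl; case: (leP b (wlen p)) => h1; case: (leP b _) => h2 //.
  by exfalso; lra.
by rewrite opprD addrA.
Qed.
Fact wcat1 : left_id wone wcat.
Proof.
move=> p; apply: word_eq => [/=|b /=]; first by rewrite add0r.
rewrite subr0; case: leP => // h; rewrite wfun_out //; apply/negP => /andP[h1 _]; lra.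
Qed.
Fact wcatr1 : right_id wone wcat.
Proof.
move=> p; apply: word_eq => [/=|b /=]; first by rewrite addr0.
case: leP => // h; rewrite wfun_out //; apply/negP => /andP[_ h1]; lra.
Qed.

HB.instance Definition _ := isMonoid.Build (word Sigma) wcatA wcat1 wcatr1.

Lemma wlenM p q : wlen (p * q)%g = wlen p + wlen q.
Proof. by []. Qed.

Lemma wfunM p q b :
  (p * q)%g b = if b <= wlen p then p b else q (b - wlen p).
Proof. by []. Qed.

Fact wbar_funE p b :
  isSome (omap (@linv Sigma) (p (wlen p + 1 - b))) = (1 <= b <= wlen p).
Proof.
transitivity (isSome (p (wlen p + 1 - b))); first by case: (p _).
by rewrite wfunE; apply/andP/andP => -[h1 h2]; split; lra.
Qed.
Definition wbar p : word Sigma := Word (wlen_ge0 p) (wbar_funE p).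

Lemma wbarK : involutive wbar.
Proof.
move=> p; apply: word_eq => [//|b /=].
have -> : wlen p + 1 - (wlen p + 1 - b) = b by lra.
by case: (p b) => //= a; rewrite linvK.
Qed.

Lemma wbarM p q : wbar (p * q)%g = (wbar q * wbar p)%g.
Proof.
apply: word_eq => [/=|b]; first by rewrite addrC.
rewrite wfunM /=; case: (leP b (wlen q)) => h2; case: leP => h1.
- by exfalso; lra.
- by congr (omap _ (q _)); lra.
- by congr (omap _ (p _)); lra.
- exfalso; have : 1 <= b - wlen q by apply: gt0_ge1_Zt; lra.
  lra.
Qed.

Fact wletter_ge0 : 0 <= (1 : Zt). Proof. exact: ler01. Qed.
Fact wletter_funE (a : letter Sigma) b :
  isSome (if b == 1 then Some a else None) = (1 <= b <= 1).
Proof. by rewrite -eq_le eq_sym; case: eqP. Qed.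
Definition wletter (a : letter Sigma) : word Sigma :=
  Word wletter_ge0 (wletter_funE a).

(* The identification of Γ^* with the finite words. *)
Definition finw (s : fword Sigma) : word Sigma := (\prod_(a <- s) wletter a)%g.

Lemma finw_nil : finw [::] = 1%g.
Proof. exact: big_nil. Qed.

Lemma finw_cons a s : finw (a :: s) = (wletter a * finw s)%g.
Proof. exact: big_cons. Qed.

Lemma finw_cat s t : finw (s ++ t) = (finw s * finw t)%g.
Proof. exact: big_cat. Qed.

Lemma wlen_finw s : wlen (finw s) = (size s)%:R.
Proof.
elim: s => [|a s IH]; first by rewrite finw_nil.
by rewrite finw_cons wlenM IH /= -natr1 addrC.
Qed.

Lemma wbar_letter a : wbar (wletter a) = wletter (linv a).
Proof.
apply: word_eq => // b /=.
have -> : (1 + 1 - b == 1 :> Zt) = (b == 1) by apply/eqP/eqP => h; lra.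
by case: ifP.
Qed.

Lemma wbar_finw s : wbar (finw s) = finw (finv s).
Proof.
elim: s => [|a s IH].
  rewrite /finv /= finw_nil; apply: word_eq => // b /=.
rewrite finw_cons wbarM IH wbar_letter -cat1s finv_cat finw_cat.
by rewrite /finv /= finw_cons finw_nil mulg1.
Qed.

Lemma finw_surj w (n : nat) : wlen w = n%:R -> exists s, w = finw s.
Proof.
elim: n w => [|n IH] w hw.
  exists [::]; rewrite finw_nil; apply: word_eq => // b /=.
  rewrite wfun_out // hw; apply/negP => /andP[h1 h2]; lra.
have n0 : 0 <= n%:R :> Zt by [].
rewrite -natr1 in hw.
have := wfunE w 1; rewrite hw lexx /=.
have -> : 1 <= n%:R + 1 :> Zt by lra.
case e : (w 1) => [a|//] _.
pose f b : option (letter Sigma) := if 1 <= b then w (b + 1) else None.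
have hf b : isSome (f b) = (1 <= b <= n%:R).
  rewrite /f; case: (leP 1 b) => h1 //=; rewrite wfunE hw.
  by apply/andP/idP => [[h2 h3]|h2]; [lra|split; lra].
have [s hs] := IH (Word n0 hf) erefl.
exists (a :: s); rewrite finw_cons -hs; apply: word_eq => [/=|b /=].
  by rewrite hw addrC.
case: eqP => [->|ne]; first by rewrite lexx.
case: leP => h.
  rewrite wfun_out //; apply/negP => /andP[h1 h2]; apply: ne; apply: le_anti.
  by rewrite h h1.
rewrite /f; have -> : b - 1 + 1 = b by lra.
case: leP => // h3; exfalso; have : 1 <= b - 1 by apply: gt0_ge1_Zt; lra.
lra.
Qed.

Definition freely_reduced x : Prop :=
  forall b, 1 <= b < wlen x -> x b <> omap (@linv Sigma) (x (b + 1)).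

Definition cyclically_reduced x : Prop := freely_reduced (x * x)%g.

(* R(A, G); the non-empty finite factors of x are the words [finw s] with s
   non-empty. *)
Definition G_reduced x : Prop :=
  forall p q s, x = (p * finw s * q)%g -> fpi s = 1%g -> s = [::].

Lemma freely_G_reduced x : freely_reduced x -> G_reduced x.
Proof.
move=> hx p q s ex s1; case: (boolP (fred s)) => [hs|]; first exact: fred_fpi1.
move=> /not_fred[s1' [a [s2 es]]]; exfalso.
have {ex es s1} [p' [q' e]] :
    exists p' q', x = (p' * (wletter a * (wletter (linv a) * q')))%g.
  exists (p * finw s1')%g, (finw s2 * q)%g.
  by rewrite ex es !finw_cat !finw_cons finw_nil mulg1 !mulgA.
have hp := wlen_ge0 p'; have hq := wlen_ge0 q'.
apply: (hx (wlen p' + 1)); first by rewrite e !wlenM /=; lra.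
rewrite {}e !wfunM /=.
have -> : (wlen p' + 1 <= wlen p') = false by apply/negP => h; lra.
have -> : (wlen p' + 1 + 1 <= wlen p') = false by apply/negP => h; lra.
have -> : wlen p' + 1 - wlen p' = 1 by lra.
have -> : wlen p' + 1 + 1 - wlen p' = 2 by lra.
have -> : (2 <= 1 :> Zt) = false by apply/negP => h; lra.
have -> : 2 - 1 = 1 :> Zt by lra.
by rewrite lexx eqxx /= linvK.
Qed.

Lemma G_reduced_bar x : G_reduced x -> G_reduced (wbar x).
Proof.
move=> hx p q s e s1.
suff : finv s = [::] by move/(congr1 (@finv Sigma)); rewrite finvK.
apply: (hx (wbar q) (wbar p)); last by rewrite fpi_finv s1 invg1.
by rewrite -[x]wbarK e !wbarM wbar_finw mulgA.
Qed.

(* R^*(A, G), the submonoid generated by R(A, G). *)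
Inductive G_star : word Sigma -> Prop :=
  | G_star1 : G_star 1%g
  | G_star_red u : G_reduced u -> G_star u
  | G_starM u w : G_star u -> G_star w -> G_star (u * w)%g.

Inductive M_rel : word Sigma -> word Sigma -> Prop :=
  MRel u (l r : fword Sigma) : G_reduced u -> fpi l = fpi r ->
    M_rel (u * finw l * wbar (finw r) * wbar u)%g 1%g.

End Words.

Section GroupE.
Variable Sigma : Type.

Definition Mquot : Type := mquot (@M_rel Sigma).
HB.instance Definition _ := Monoid.on Mquot.

Definition Mclass (w : word Sigma) : Mquot := mproj (@M_rel Sigma) w.

Definition in_E (m : Mquot) : Prop := exists2 w, G_star w & m = Mclass w.

Record E : Type := MkE { E_val : Mquot; E_valP : in_E E_val }.

HB.instance Definition _ := gen_eqMixin E.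
HB.instance Definition _ := gen_choiceMixin E.

Lemma E_val_inj : injective E_val.
Proof.
case=> [m hm] [m' hm'] /= e; case: m' / e hm' => hm'.
by congr MkE; apply: Prop_irrelevance.
Qed.

Fact in_E1 : in_E 1%g.
Proof. by exists 1%g; first exact: G_star1. Qed.

Fact in_EM m m' : in_E m -> in_E m' -> in_E (m * m')%g.
Proof.
move=> [w hw ->] [w' hw' ->]; exists (w * w')%g; first exact: G_starM.
by rewrite /Mclass mprojM.
Qed.

Lemma M_rel_bar (x y : word Sigma) : M_rel x y -> M_rel (wbar x) (wbar y).
Proof.
case=> u l r hu e; have -> : wbar (1%g : word Sigma) = 1%g.
  by rewrite -finw_nil wbar_finw.
by rewrite !wbarM !wbarK !mulgA; apply: MRel.
Qed.

Lemma cong_bar (x y : word Sigma) :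
  cong (@M_rel Sigma) x y -> cong (@M_rel Sigma) (wbar x) (wbar y).
Proof.
elim=> {x y} [x y /M_rel_bar/cong_rel //|x|x y _ IH|x y z _ h _ h'|x y x' y' _ h _ h'].
- exact: cong_refl.
- exact: cong_sym.
- exact: cong_trans h h'.
- by rewrite !wbarM; apply: cong_mul.
Qed.

Definition Mbar (m : Mquot) : Mquot := Mclass (wbar (repr m)).

Lemma Mbar_class w : Mbar (Mclass w) = Mclass (wbar w).
Proof.
apply/mprojP/cong_bar/mprojP; exact: mprojK.
Qed.

Lemma G_star_bar (w : word Sigma) : G_star w -> G_star (wbar w).
Proof.
elim=> [|u hu|u v _ hu _ hv].
- by rewrite -finw_nil wbar_finw finw_nil; apply: G_star1.
- exact/G_star_red/G_reduced_bar.
- by rewrite wbarM; apply: G_starM.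
Qed.

Fact in_E_bar m : in_E m -> in_E (Mbar m).
Proof.
by move=> [w hw ->]; rewrite Mbar_class; exists (wbar w) => //; apply: G_star_bar.
Qed.

Lemma Mclass_mulV (w : word Sigma) :
  G_star w -> (Mclass w * Mclass (wbar w))%g = 1%g.
Proof.
elim=> [|u hu|u v _ hu _ hv].
- by rewrite -finw_nil wbar_finw finw_nil mulg1.
- rewrite /Mclass -mprojM; apply/mprojP/cong_rel.
  have := MRel hu (erefl (fpi [::])).
  by rewrite wbar_finw finw_nil !mulg1.
- by rewrite wbarM /Mclass !mprojM mulgA -[(_ * _ * mproj _ (wbar v))%g]mulgA hv mulg1.
Qed.

Definition E_one : E := MkE in_E1.
Definition E_mul (g h : E) : E := MkE (in_EM (E_valP g) (E_valP h)).
Definition E_inv (g : E) : E := MkE (in_E_bar (E_valP g)).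

Fact E_mulA : associative E_mul.
Proof. by move=> g h k; apply: E_val_inj; rewrite /= mulgA. Qed.
Fact E_mul1 : left_id E_one E_mul.
Proof. by move=> g; apply: E_val_inj; rewrite /= mul1g. Qed.
Fact E_mulr1 : right_id E_one E_mul.
Proof. by move=> g; apply: E_val_inj; rewrite /= mulg1. Qed.

Fact E_mulgV : right_inverse E_one E_inv E_mul.
Proof.
move=> g; apply: E_val_inj => /=; case: (E_valP g) => w hw ->.
by rewrite Mbar_class Mclass_mulV.
Qed.

Fact E_mulVg : left_inverse E_one E_inv E_mul.
Proof.
move=> g; apply: E_val_inj => /=; case: (E_valP g) => w hw ->.
by rewrite Mbar_class -{2}[w]wbarK Mclass_mulV //; apply: G_star_bar.
Qed.

HB.instance Definition _ := isMonoid.Build E E_mulA E_mul1 E_mulr1.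
HB.instance Definition _ := hasInv.Build E E_inv.
HB.instance Definition _ := Monoid_isGroup.Build E E_mulVg E_mulgV.

End GroupE.

Section PartialMonoid.
Variable Sigma : Type.

(* [star x y z] is the graph of the partial operation x * y = z. *)
Definition star (x y z : word Sigma) : Prop :=
  exists p q r, [/\ x = (p * q)%g, y = (wbar q * r)%g,
                    freely_reduced (p * r)%g & z = (p * r)%g].

Definition in_CDR (x : word Sigma) : Prop :=
  freely_reduced x /\
  exists c u, cyclically_reduced u /\ x = (c * u * wbar c)%g.

Record CDR : Type := MkCDR { CDR_word :> word Sigma; CDR_wordP : in_CDR CDR_word }.

Lemma CDR_in_E (x : CDR) : in_E (Mclass x).
Proof.
exists (CDR_word x) => //; apply/G_star_red/freely_G_reduced.
by case: (CDR_wordP x).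
Qed.

Definition CDR_to_E (x : CDR) : E Sigma := MkE (CDR_in_E x).

End PartialMonoid.

(* Main.v *)
Require Import Defs.
From mathcomp Require Import all_boot.
From mathcomp Require Import all_order all_algebra boolp lra.
From Stdlib Require Import Relation_Operators.

Set Implicit Arguments.
Unset Strict Implicit.
Unset Printing Implicit Defensive.

Import Order.TTheory GRing.Theory Num.Theory.

Local Open Scope ring_scope.

(** In the free group a word trivial in [F(Sigma)] collapses by deleting
    factors [a a^-1], so the congruence defining [M(A, F(Sigma))] is generated
    by the single family of rewriting steps [p u u^- q -> p q] with [u] reduced
    and [u^-] its involute ([step]).

    These steps are not well-founded, since lengths in [Z[t]] can decrease for
    ever, but they have the diamond property ([step_diamond]), which gives
    confluence without any termination argument.  Indeed a reduced word
    contains no factor [v v^-] with [v] nonempty, so the centre of one redex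
    never lies strictly inside a half of another one.  Two redexes therefore
    have the same centre and are nested, or they are disjoint, or the right
    half of the first overlaps the left half of the second; in each case one
    further step on either side closes the diamond.

    Hence congruent words have a common descendant ([cong_joinable]).  A
    reduced word only rewrites to itself, so distinct reduced words have
    distinct classes.  If [x], [y], [z] are reduced and [x y = z] in [E], then
    [x y] rewrites to [z]; every nontrivial redex of a product of two reduced
    words is centred at their junction, so the rewriting successively peels off
    [x] and [y] factors that cancel, which exhibits [x = p q], [y = q^- r] and
    [z = p r] ([steps_star]). *)

(** * Factorizations of words *)

Section Factorization.
Variable Sigma : Type.
Implicit Types p q u v w x y : word Sigma.

Lemma wbar1 : wbar (1%g : word Sigma) = 1%g.
Proof. by rewrite -finw_nil wbar_finw. Qed.

Lemma wlen_wbar w : wlen (wbar w) = wlen w.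
Proof. by []. Qed.

Lemma wcat_inj p q p' q' :
  (p * q)%g = (p' * q')%g -> wlen p = wlen p' -> p = p' /\ q = q'.
Proof.
move=> e hl; have hq : wlen q = wlen q'.
  by have := congr1 (@wlen _) e; rewrite !wlenM hl => /addrI.
have E b : (p * q)%g b = (p' * q')%g b by rewrite e.
split; apply: word_eq => // b.
  have := E b; rewrite !wfunM -hl; case: (leP b (wlen p)) => // h _.
  by rewrite !wfun_out // -?hl [b <= _]leNgt h andbF.
case: (boolP (1 <= b)) => h; last by rewrite !wfun_out // (negPf h).
have := E (b + wlen p); rewrite !wfunM -hl addrK.
by have -> : (b + wlen p <= wlen p) = false by apply/negP; lra.
Qed.

Lemma wlen_eq0 x : wlen x = 0 -> x = 1%g.
Proof.
move=> h; have [] // := @wcat_inj x 1%g 1%g x; first by rewrite mul1g mulg1.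
Qed.

Lemma wcat_eq1 p q : (p * q)%g = 1%g -> p = 1%g /\ q = 1%g.
Proof.
move=> /(congr1 (@wlen _))/eqP; rewrite wlenM paddr_eq0 ?wlen_ge0 //.
by move=> /andP[/eqP hp /eqP hq]; split; apply: wlen_eq0.
Qed.

Lemma wbar_eq1 w : wbar w = 1%g -> w = 1%g.
Proof. by move=> h; rewrite -[w]wbarK h wbar1. Qed.

Variant triv_spec x : Prop :=
  | TrivWord of x = 1%g
  | NontrivWord of 0 < wlen x.

Lemma trivP x : triv_spec x.
Proof.
have := wlen_ge0 x; rewrite le_eqVlt => /orP[/eqP h|]; last exact: NontrivWord.
exact/TrivWord/wlen_eq0.
Qed.

Lemma wsplit w (a : Zt) : 0 <= a <= wlen w ->
  exists p q, w = (p * q)%g /\ wlen p = a.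
Proof.
move=> /andP[a0 aw].
have hf b : isSome (if b <= a then w b else None) = (1 <= b <= a).
  case: (leP b a) => h; last by rewrite andbF.
  by rewrite wfunE; apply/andP/andP => -[h1 h2]; split; lra.
have a1 : 0 <= wlen w - a by lra.
have hg b : isSome (if 1 <= b then w (b + a) else None)
              = (1 <= b <= wlen w - a).
  case: (leP 1 b) => h //=; rewrite wfunE.
  by apply/andP/idP => [[h1 h2]|h1]; [lra|split; lra].
exists (Word a0 hf), (Word a1 hg); split => //.
apply: word_eq => [/=|b]; first by lra.
rewrite wfunM /=; case: (leP b a) => [|h] //.
by rewrite subrK (@gt0_ge1_Zt (b - a)) // subr_gt0.
Qed.

(** Levi's lemma, which turns every comparison of positions in a word into a
    common refinement of two factorizations. *)
Lemma levi p q p' q' : (p * q)%g = (p' * q')%g -> wlen p <= wlen p' ->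
  exists m, p' = (p * m)%g /\ q = (m * q')%g.
Proof.
move=> e hl; have [|p1 [m [ep hp1]]] := @wsplit p' (wlen p).
  by rewrite wlen_ge0 hl.
have := e; rewrite ep -mulgA => /wcat_inj[//|ep1 eq].
by exists m; rewrite ep1.
Qed.

Lemma last_letter x : 0 < wlen x ->
  exists x' a, x = (x' * finw [:: a])%g.
Proof.
move=> /gt0_ge1_Zt h; have [|x' [w [ex hx']]] := @wsplit x (wlen x - 1).
  by apply/andP; split; lra.
have w1 : wlen w = 1%:R.
  by have := congr1 (@wlen _) ex; rewrite wlenM hx'; lra.
have [s es] := finw_surj w1; move: w1; rewrite es wlen_finw => /eqP.
rewrite eqr_nat => /eqP hs; case: s es hs => [|a [|]] //= ew _.
by exists x', a; rewrite ex ew.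
Qed.

(** * Reduced words contain no cancelling pair *)

Lemma G_reduced_factor p x q : G_reduced (p * x * q)%g -> G_reduced x.
Proof.
move=> h p' q' s e; apply: (h (p * p')%g (q' * q)%g).
by rewrite e !mulgA.
Qed.

Lemma G_reduced_prefix x q : G_reduced (x * q)%g -> G_reduced x.
Proof. by move=> h; apply: (@G_reduced_factor 1%g x q); rewrite mul1g. Qed.

Lemma G_reduced_suffix p x : G_reduced (p * x)%g -> G_reduced x.
Proof. by move=> h; apply: (@G_reduced_factor p x 1%g); rewrite mulg1. Qed.

(** An interior cut [m | n] of a reduced word is never the centre of a
    nonempty factor [v v^-], even when [v] is longer than [m] or [n]: only the
    last letter of [v], hence of [m], and the first letter of [v^-], hence of
    [n], matter. *)
Lemma no_inner_center a v b m c n d :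
  (a * v)%g = (b * m)%g -> (wbar v * c)%g = (n * d)%g ->
  G_reduced (m * n)%g -> [\/ v = 1%g, m = 1%g | n = 1%g].
Proof.
case: (trivP v) => [|hv]; first by constructor 1.
case: (trivP m) => [|hm]; first by constructor 2.
case: (trivP n) => [|hn]; first by constructor 3.
have [v' [l ev]] := last_letter hv; have [m' [l' em]] := last_letter hm.
have [n' [l'' en]] : exists n' l'', n = (finw [:: l''] * n')%g.
  have [n' [l'' e]] : exists n' l'', wbar n = (n' * finw [:: l''])%g.
    by apply: last_letter.
  exists (wbar n'), (linv l''); rewrite -[n]wbarK e wbarM wbar_finw.
  by congr (_ * _)%g.
subst v m n => e1 e2; rewrite !mulgA in e1.
have el : finw [:: l] = finw [:: l'].
  case: (wcat_inj e1) => // ; have := congr1 (@wlen _) e1.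
  by rewrite !wlenM !wlen_finw /= => /addIr.
have el'' : wbar (finw [:: l]) = finw [:: l''].
  have := e2; rewrite wbarM -!mulgA => /wcat_inj[] //.
  by rewrite wlen_wbar !wlen_finw.
move=> /(_ m' n' ([:: l] ++ Defs.finv [:: l])).
rewrite finw_cat -wbar_finw el'' el fpi_cat fpi_mulV !mulgA.
by move=> /(_ erefl erefl).
Qed.

Lemma reduced_cancel p u q :
  G_reduced (p * u * wbar u * q)%g -> u = 1%g.
Proof.
move=> h; have h' : G_reduced (u * wbar u)%g.
  by apply: (@G_reduced_factor p _ q); rewrite mulgA.
case: (@no_inner_center 1%g u 1%g u 1%g (wbar u) 1%g) => //.
by move=> e; rewrite -[u]wbarK e wbar1.
Qed.

(** A redex straddling the product of two reduced words is centred at their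
    junction. *)
Lemma reduced_junction x y p u q :
  G_reduced x -> G_reduced y -> (x * y)%g = (p * u * (wbar u * q))%g ->
  u = 1%g \/ x = (p * u)%g /\ y = (wbar u * q)%g.
Proof.
move=> hx hy e; case: (leP (wlen x) (wlen (p * u)%g)) => hl.
  have [k [ek ey]] := levi e hl; rewrite ey in hy.
  have ey1 : (wbar u * q)%g = (wbar u * q * 1)%g by rewrite mulg1.
  case: (no_inner_center ek ey1 hy) => [u1|k1|/wcat_eq1[/wbar_eq1 u1 _]].
  - by left.
  - by right; rewrite ey ek k1 !mulg1 mul1g.
  - by left.
have [k [ek ey]] := levi (esym e) (ltW hl); rewrite ek in hx hl.
have epu : (p * u)%g = (1 * (p * u))%g by rewrite mul1g.
case: (no_inner_center epu ey hx) => [u1|/wcat_eq1[_ u1]|k1]; try by left.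
by rewrite k1 mulg1 ltxx in hl.
Qed.

End Factorization.

(** * The rewriting system and its confluence *)

Section Rewriting.
Variable Sigma : Type.
Implicit Types p q u v w x y z : word Sigma.

(** The empty [u] is allowed, which makes a step reflexive and lets the diamond
    property hold in its plain form, with exactly one step on each side. *)
Definition step x y : Prop :=
  exists p u q, [/\ x = (p * u * wbar u * q)%g, y = (p * q)%g & G_reduced u].

Notation steps := (clos_refl_trans_1n (word Sigma) step).

Lemma step_redex x y p u q :
  x = (p * u * wbar u * q)%g -> y = (p * q)%g -> G_reduced u -> step x y.
Proof. by exists p, u, q. Qed.

Lemma step_refl x : step x x.
Proof.
apply: (@step_redex _ _ x 1%g 1%g); rewrite ?wbar1 ?mulg1 //.
apply: freely_G_reduced => b /= /andP[h1 h2]; exfalso; lra.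
Qed.

(** Redexes with the same centre are nested, and the reduct by the longer one is
    reached from the other by deleting what is left of it around the centre. *)
Lemma step_diamond_same_center p u q p' v q' :
  G_reduced v -> (p * u)%g = (p' * v)%g ->
  (wbar u * q)%g = (wbar v * q')%g -> wlen u <= wlen v ->
  step (p * q)%g (p' * q')%g.
Proof.
move=> hv e1 e2 hl; have [|k [ep ev]] := levi (esym e1).
  by have := congr1 (@wlen _) e1; rewrite !wlenM; lra.
move: e2; rewrite ev wbarM -mulgA => /wcat_inj[//|_ ->].
apply: (@step_redex _ _ p' k q'); rewrite ?ep ?mulgA //.
by apply: (@G_reduced_prefix _ k u); rewrite -ev.
Qed.

(** The second redex has its centre at or after the end of the right half [u^-]
    of the first one.  If [v] is no longer than [n], the redexes are disjoint and commute.
    Otherwise [u^-] and [v] overlap in a word [o], so that [u^- = k o] and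
    [v = o n]; the whole word is [p o^- k^- k o n n^- o^- q'] and both one-step
    reducts rewrite to [p o^- q']. *)
Lemma step_diamond_overlap p q p' q' u v m n :
  G_reduced u -> G_reduced v -> 0 < wlen u -> m = (wbar u * n)%g ->
  (p' * v)%g = (p * u * m)%g -> q = (n * (wbar v * q'))%g ->
  exists2 t, step (p * q)%g t & step (p' * q')%g t.
Proof.
move=> hu hv u0 -> e1 ->; rewrite mulgA in e1.
case: (leP (wlen v) (wlen n)) => hvn.
  have [|k [ep' en]] := levi (esym e1).
    by have := congr1 (@wlen _) e1; rewrite !wlenM; lra.
  exists (p * (k * q'))%g.
    by apply: (@step_redex _ _ (p * k)%g v q'); rewrite ?en ?mulgA.
  by apply: (@step_redex _ _ p u (k * q')%g); rewrite ?ep' ?mulgA.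
have [|o [e2 ev]] := levi e1.
  by have := congr1 (@wlen _) e1; rewrite !wlenM; lra.
case: (leP (wlen o) (wlen u)) => hou.
  have [|k [ep' eu]] := levi e2.
    by have := congr1 (@wlen _) e2; rewrite !wlenM wlen_wbar; lra.
  have eu' : u = (wbar o * wbar k)%g by rewrite -wbarM -eu wbarK.
  exists (p * (wbar o * q'))%g.
    apply: (@step_redex _ _ p n (wbar o * q')%g) => //.
      by rewrite ev wbarM !mulgA.
    by apply: (@G_reduced_suffix _ o); rewrite -ev.
  apply: (@step_redex _ _ (p * wbar o)%g (wbar k) q'); rewrite ?mulgA //.
    by rewrite wbarK ep' eu' !mulgA.
  by apply: (@G_reduced_suffix _ (wbar o)); rewrite -eu'.
(* Otherwise the centre of the first redex would lie inside [v]. *)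
exfalso; have [|k [epu eo]] := levi (esym e2).
  by have := congr1 (@wlen _) e2; rewrite !wlenM wlen_wbar; lra.
have ok : 0 < wlen k.
  by have := congr1 (@wlen _) eo; rewrite wlenM wlen_wbar; lra.
case: (@no_inner_center _ p u p' k n (wbar u * n)%g 1%g); rewrite ?mulg1 //.
- by rewrite mulgA -eo -ev.
- by move=> u1; rewrite u1 ltxx in u0.
- by move=> k1; rewrite k1 ltxx in ok.
by move=> /wcat_eq1[/wbar_eq1 u1 _]; rewrite u1 ltxx in u0.
Qed.

Lemma step_diamond_nontrivial p q p' q' u v :
  G_reduced u -> G_reduced v -> 0 < wlen u -> 0 < wlen v ->
  wlen (p * u)%g <= wlen (p' * v)%g ->
  (p * u * (wbar u * q))%g = (p' * v * (wbar v * q'))%g ->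
  exists2 t, step (p * q)%g t & step (p' * q')%g t.
Proof.
move=> hu hv u0 v0 hl e; have [m [e1 e2]] := levi e hl.
have same : m = 1%g -> exists2 t, step (p * q)%g t & step (p' * q')%g t.
  move=> m1; move: e1 e2; rewrite m1 mulg1 mul1g => e1 e2.
  case: (leP (wlen u) (wlen v)) => huv.
    by exists (p' * q')%g; [apply: step_diamond_same_center huv | apply: step_refl].
  exists (p * q)%g; first exact: step_refl.
  by apply: step_diamond_same_center (ltW huv).
case: (leP (wlen (wbar u)) (wlen m)) => hum.
  have [n [em eq]] := levi e2 hum.
  exact: step_diamond_overlap em e1 eq.
have [n [eu eq]] := levi (esym e2) (ltW hum).
have hmn : G_reduced (m * n)%g by rewrite -eu; apply: G_reduced_bar.
case: (no_inner_center e1 eq hmn) => [v1|//|n1]; first by rewrite v1 ltxx in v0.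
by rewrite eu n1 mulg1 ltxx in hum.
Qed.

Lemma step_diamond x y z : step x y -> step x z ->
  exists2 t, step y t & step z t.
Proof.
move=> [p [u [q [ex -> hu]]]] [p' [v [q' [ez -> hv]]]].
have xz : step x (p' * q')%g by exists p', v, q'.
have xy : step x (p * q)%g by exists p, u, q.
case: (trivP u) => [u1|u0].
  exists (p' * q')%g; last exact: step_refl.
  by move: xz; rewrite ex u1 wbar1 !mulg1.
case: (trivP v) => [v1|v0].
  exists (p * q)%g; first exact: step_refl.
  by move: xy; rewrite ez v1 wbar1 !mulg1.
have e : (p * u * (wbar u * q))%g = (p' * v * (wbar v * q'))%g.
  by move: ez; rewrite ex !mulgA.
have [hl|/ltW hl] := leP (wlen (p * u)%g) (wlen (p' * v)%g).
  exact: step_diamond_nontrivial e.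
by have [t] := step_diamond_nontrivial hv hu v0 u0 hl (esym e); exists t.
Qed.

Lemma step_mul a b x y : step x y -> step (a * x * b)%g (a * y * b)%g.
Proof.
by move=> [p [u [q [-> -> hu]]]]; exists (a * p)%g, u, (q * b)%g; rewrite !mulgA.
Qed.

Lemma steps_mul a b x y : steps x y -> steps (a * x * b)%g (a * y * b)%g.
Proof.
elim=> [{}x|{}x {}y z xy _ IH]; first exact: rt1n_refl.
by apply: rt1n_trans IH; apply: step_mul.
Qed.

Lemma steps1 x y : step x y -> steps x y.
Proof. by move=> h; apply: rt1n_trans h (rt1n_refl _ _ _). Qed.

Lemma steps_trans x y z : steps x y -> steps y z -> steps x z.
Proof.
by move=> xy yz; elim: xy yz => // {}x {}y w xy _ IH /IH; apply: rt1n_trans.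
Qed.

Lemma steps_strip x y z : steps x z -> step x y ->
  exists2 t, steps y t & step z t.
Proof.
move=> xz; elim: xz y => [{}x y xy|{}x x' {}z xx' _ IH y xy].
  by exists y => //; apply: rt1n_refl.
have [t yt x't] := step_diamond xy xx'; have [s ts zs] := IH _ x't.
by exists s => //; apply: rt1n_trans ts.
Qed.

Definition joinable x y : Prop := exists2 t, steps x t & steps y t.

Lemma steps_confluent x y z : steps x y -> steps x z -> joinable y z.
Proof.
move=> xy; elim: xy z => [{}x z xz|{}x x' {}y xx' _ IH z xz].
  by exists z => //; apply: rt1n_refl.
have [t x't zt] := steps_strip xz xx'; have [s ys ts] := IH _ x't.
by exists s => //; apply: rt1n_trans ts.
Qed.

Lemma letter_reduced (a : letter Sigma) : G_reduced (wletter a).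
Proof. by apply: freely_G_reduced => b /= /andP[h1 h2]; exfalso; lra. Qed.

(** Deleting adjacent pairs of inverse letters empties any finite word that
    represents the identity. *)
Lemma finw_steps1 (s : fword Sigma) : fpi s = 1%g -> steps (finw s) 1%g.
Proof.
have [n] := ubnP (size s); elim: n s => // n IH s hn s1.
case: (boolP (fred s)) => [hs|/not_fred[s1' [a [s2 es]]]].
  by rewrite (fred_fpi1 hs s1) finw_nil; apply: rt1n_refl.
apply: (@rt1n_trans _ _ _ (finw (s1' ++ s2))).
  apply: (@step_redex _ _ (finw s1') (wletter a) (finw s2)).
  - by rewrite es !finw_cat !finw_cons finw_nil mulg1 wbar_letter !mulgA.
  - exact: finw_cat.
  - exact: letter_reduced.
apply: IH; first by move: hn; rewrite es !size_cat /= !addnS ltnS => /ltnW.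
have : fpi [:: a; linv a] = 1%g by rewrite -(fpi_mulV [:: a]) -fpi_cat.
by move: s1; rewrite es !fpi_cat => s1 aV; rewrite aV mul1g in s1.
Qed.

(** The Church-Rosser property for the congruence of [M(A, F(Sigma))]: a defining
    relator [u l r^- u^-] rewrites to [u u^-] and then to [1], and confluence
    makes joinability transitive. *)
Lemma cong_joinable x y : cong (@M_rel Sigma) x y -> joinable x y.
Proof.
elim=> {x y} [_ _ [u l r hu e]|x|x y _ [t]|x y z _ [t xt yt] _ [s ys zs]
             |x y x' y' _ [t xt x't] _ [s ys y's]].
- exists 1%g; last exact: rt1n_refl.
  apply: (@steps_trans _ (u * wbar u)%g).
    rewrite wbar_finw -(mulgA u) -finw_cat -[X in steps _ (X * _)%g]mulg1.
    by apply/steps_mul/finw_steps1; rewrite fpi_cat fpi_finv e mulgV.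
  by apply/steps1/(@step_redex _ _ 1%g u 1%g); rewrite ?mulg1 ?mul1g.
- by exists x; apply: rt1n_refl.
- by exists t.
- have [w tw sw] := steps_confluent yt ys.
  by exists w; [apply: steps_trans tw | apply: steps_trans sw].
have mul2 a b a' b' : steps a a' -> steps b b' -> steps (a * b)%g (a' * b')%g.
  move=> ha hb; apply: (@steps_trans _ (a' * b)%g).
    by have := steps_mul 1%g b ha; rewrite !mul1g.
  by have := steps_mul a' 1%g hb; rewrite !mulg1.
by exists (t * s)%g; apply: mul2.
Qed.

(** * Reduced words as normal forms *)

Lemma steps_reduced x y : G_reduced x -> steps x y -> y = x.
Proof.
move=> hx xy; elim: xy hx => // {}x x' {}y [p [u [q [ex ex' _]]]] _ IH hx.
have u1 : u = 1%g by apply: (@reduced_cancel _ p u q); rewrite -ex.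
have exx : x' = x by rewrite ex ex' u1 wbar1 !mulg1.
by rewrite exx in IH; apply: IH.
Qed.

Lemma cong_steps x y : G_reduced y -> cong (@M_rel Sigma) x y -> steps x y.
Proof. by move=> hy /cong_joinable[t xt /(steps_reduced hy) <-]. Qed.

Lemma Mclass_inj_reduced x y :
  G_reduced x -> G_reduced y -> Mclass x = Mclass y -> x = y.
Proof.
by move=> hx hy /mprojP/(cong_steps hy)/(steps_reduced hx).
Qed.

(** As long as both factors stay reduced, a nontrivial step deletes a suffix [u]
    of the first one and the prefix [u^-] of the second one; the deleted suffixes
    accumulate into the cancelled part of the partial product. *)
Lemma steps_star x y z :
  G_reduced x -> G_reduced y -> freely_reduced z -> steps (x * y)%g z ->
  star x y z.
Proof.
move=> hx hy hz; move ew: (x * y)%g => w wz.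
elim: wz x y hx hy hz ew => [{}w|{}w w' {}z [p [u [q [e e' hu]]]] _ IH] x y hx hy hz ew.
  by exists x, 1%g, y; rewrite wbar1 mulg1 mul1g ew.
have [u1|[ex ey]] : u = 1%g \/ x = (p * u)%g /\ y = (wbar u * q)%g.
  by apply: reduced_junction => //; rewrite ew e !mulgA.
  by apply: IH => //; rewrite ew e e' u1 wbar1 !mulg1.
have hp : G_reduced p by apply: (@G_reduced_prefix _ _ u); rewrite -ex.
have hq : G_reduced q by apply: (@G_reduced_suffix _ (wbar u)); rewrite -ey.
have [p1 [r1 [q1 [ep eq hz' ez]]]] := IH p q hp hq hz (esym e').
by exists p1, (r1 * u)%g, q1; rewrite wbarM ex ey ep eq !mulgA.
Qed.

Lemma star_Mclass x y z :
  G_reduced x -> star x y z -> Mclass z = (Mclass x * Mclass y)%g.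
Proof.
move=> hx [p [q [r [ex -> _ ->]]]].
have hq : G_reduced q by apply: (@G_reduced_suffix _ p); rewrite -ex.
rewrite ex /Mclass !mprojM !mulgA -(mulgA (mproj _ p)).
by rewrite -/(Mclass q) -/(Mclass (wbar q)) Mclass_mulV ?mulg1 //; apply: G_star_red.
Qed.

End Rewriting.

Theorem mainTheorem7 (Sigma : Type) :
  injective (@CDR_to_E Sigma) /\
  forall x y : CDR Sigma,
    ((exists z : CDR Sigma, star x y z) <->
     (exists z : CDR Sigma, CDR_to_E z = (CDR_to_E x * CDR_to_E y)%g)) /\
    (forall z : CDR Sigma,
       star x y z -> CDR_to_E z = (CDR_to_E x * CDR_to_E y)%g).
Proof.
have red (x : CDR Sigma) : G_reduced x.
  by apply: freely_G_reduced; case: (CDR_wordP x).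
have starE (x y z : CDR Sigma) :
    star x y z -> CDR_to_E z = (CDR_to_E x * CDR_to_E y)%g.
  by move=> h; apply: E_val_inj; apply: star_Mclass.
split=> [x y /(congr1 (@E_val _)) e|x y].
  have := Mclass_inj_reduced (red x) (red y) e.
  case: x y {e} => x hx [y hy] /= e; case: y / e hy => hy.
  by congr MkCDR; apply: Prop_irrelevance.
split=> [|z]; last exact: starE.
split=> -[z h]; exists z; first exact: starE.
apply: steps_star => //; first by case: (CDR_wordP z).
apply: cong_steps => //; apply/mprojP; rewrite mprojM.
exact: esym (congr1 (@E_val _) h).
Qed.
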